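(* Let $y\in[2,x]$ and let $A$ be a random variable taking values in $[1,x]\cap\mathbb{N}$. Fix $a\in\mathbb{Z}\setminus\{0\}$. Let $(\widetilde{G}_p)_{p\le y}$ be independent random variables, indexed by the primes $p\le y$, such that: if $p\nmid a$, then $$\mathbb{P}(\widetilde{G}_p=k)=\frac{1}{\phi(p^k)}-\frac{1}{\phi(p^{k+1})}=\begin{cases}1-\frac{1}{p-1}&\text{if }k=0,\\ p^{-k}&\text{if }k\ge 1,\end{cases}$$ and if $p\mid a$, then $\widetilde{G}_p\equiv 0$. Let $u=\log x/\log y$. For every $\theta\in(0,1)$ and $\varepsilon>0$, we have $$\mathrm{d}_{\mathrm{TV}}\big((\nu_p(A))_{p\le y},(\widetilde{G}_p)_{p\le y}\big)\ll_{a,\varepsilon,\theta}u^{-\theta u(1-\varepsilon)}+x^{-\theta(1-\varepsilon)}+\sum_{\substack{d\le x^{\theta}\\ P(d)\le y\\ (d,a)=1}}\left|\mathbb{P}(d\mid A)-\frac{1}{\phi(d)}\right|\big(2^{\omega(d)}+\log y\big)+\sum_{\substack{d\le x^{\theta}\\ P(d)\le y\\ (d,a)>1}}\mathbb{P}(d\mid A)\big(2^{\omega(d)}+\log y\big).$$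
   Context: $\mathbb{N}=\{1,2,\dots\}$; $d$ runs over positive integers and $p$ over primes. $\nu_p(n)$ is the exponent of $p$ in $n$; $\omega(d)$ is the number of distinct prime divisors of $d$; $\phi$ is Euler's totient function; $(d,a)$ is the greatest common divisor. $P(d)$ is the largest prime divisor of $d$, with $P(1)=1$. $\mathbb{P}(d\mid A)$ is the probability that $d$ divides $A$. For discrete random variables $X,Y$ with values in a countable set $\Omega$, $\mathrm{d}_{\mathrm{TV}}(X,Y)=\sup_{E\subseteq\Omega}|\mathbb{P}(X\in E)-\mathbb{P}(Y\in E)|$. $F\ll_{a,\varepsilon,\theta}G$ means $|F|\le C\,G$ with a constant $C$ depending only on $a,\varepsilon,\theta$. *)

(* Defs.v *)
From HB Require Import structures.
From mathcomp Require Export all_boot all_order all_algebra.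
From mathcomp Require Export all_classical all_reals all_analysis.

Set Implicit Arguments.
Unset Strict Implicit.
Unset Printing Implicit Defensive.

Import Order.TTheory GRing.Theory Num.Theory.

Local Open Scope classical_set_scope.
Local Open Scope ring_scope.

(* The primes p <= y, as a finite type; for y >= 0 and p : nat,
   p <= Num.truncn y is equivalent to p%:R <= y. *)
Definition primes_upto (R : realType) (y : R) : Type :=
  {p : 'I_(Num.truncn y).+1 | prime p}.

HB.instance Definition _ (R : realType) (y : R) :=
  Finite.copy (primes_upto y) {p : 'I_(Num.truncn y).+1 | prime p}.

Definition prime_val (R : realType) (y : R) (p : primes_upto y) : nat :=
  val (val p).

Coercion prime_val : primes_upto >-> nat.

Definition mutually_independent (R : realType) (d d' : measure_display)
    (T : measurableType d) (T' : measurableType d') (P : probability T R)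
    (I : finType) (X : I -> {RV P >-> T'}) : Prop :=
  forall (J : {set I}) (E : I -> set T'),
    (forall i, measurable (E i)) ->
    P (\bigcap_(i in [set` J]) (X i @^-1` E i)) =
    (\prod_(i in J) P (X i @^-1` E i))%E.

(* X and Y may live on different probability spaces. Their values range over
   a countable set carrying the discrete sigma-algebra, hence the supremum over
   all subsets; it is meaningful when all preimages under X and Y are
   measurable. *)
Definition dTV (R : realType) (d d' : measure_display)
    (T : measurableType d) (T' : measurableType d')
    (P : probability T R) (P' : probability T' R)
    (Omega : countType) (X : T -> Omega) (Y : T' -> Omega) : R :=
  sup [set `|fine (P (X @^-1` E)) - fine (P' (Y @^-1` E))| | E in [set: set Omega]].

(* Main.v *)
Require Import Defs.
From mathcomp Require Import ring lra zify.

(** By passing to complements it is enough to bound from above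
    [P'(Y in E) - P(X in E)], where [Y] is the independent model and [X] the
    vector of valuations of [A]. This difference is at most the sum, over
    exponent vectors [f], of the positive part of [P'(Y = f) - P(X = f)]. So only
    a lower bound for each [P(X = f)] is required, and a lower bound sieve
    provides it: with [m] the integer of exponents [f], the event [X = f] says
    that [m] divides [A] and no further prime [p <= y] divides [A / m], and
    [brun_valuations] bounds its probability below by an alternating sum of
    [P(m d divides A)] over certain squarefree [d] with [m d <= z = x ^ theta].

    Replacing [P(n divides A)] by the corresponding probability [ptail] of the
    model costs the two sums over [n] in the statement, because each [n] is
    [m d] with [d] squarefree in at most [2 ^ omega(n)] ways ([card_shift]). What
    is left is the error of the sieve in the model, where the primes are
    independent. Brun's sieve is used here with a parameter [Lam = exp L]: its
    relative error is [Lam ^ (- b)] and its level is [y] to the power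
    [b + O(Lam)] ([brun_defect], [brun_level]). If [b] is chosen for each [m] so
    that the level is [z / m], the relative error becomes [exp (O(Lam))] times
    [(m / z) ^ sigma] with [y ^ sigma = Lam]. Summing over [m] against the model
    is Rankin's trick: the [sigma]-th moment of the model integer is
    [exp (O(Lam))] ([model_moment_le]), and one obtains
    [exp (O(Lam)) * z ^ (- sigma)] ([sum_deficit_le]). The only information on
    primes is that the sum of [ln p / p] over [p <= y] is at most [2 ln y].

    Finally [Lam = min(u, y) ^ (1 - eps / 2)]. Then [Lam = o(u)], so
    [exp (O(Lam))] is lost in the remaining [eps / 2], and [z ^ (- sigma)] is
    [u ^ (- theta u (1 - eps / 2))] or [x ^ (- theta (1 - eps / 2))] according
    to which of [u] and [y] is smaller ([error_exponent]). *)

Set Implicit Arguments.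
Unset Strict Implicit.
Unset Printing Implicit Defensive.

Import Order.TTheory GRing.Theory Num.Theory.

Local Open Scope classical_set_scope.
Local Open Scope ring_scope.

(** * The truncated inclusion-exclusion sums *)

Section BrunSieve.
Context {R : realType} {I : eqType} (v : I -> R).

(** The sets of primes kept in Brun's sieve, listed from the largest prime
    down. The flag [o] is the parity of the number of primes already picked and
    [c] a credit: passing a prime [p] earns [v p], picking it costs [1]. A pick
    that makes the size even is refused when it would leave the credit negative.
    A refused pick, summed over all ways to go on with smaller primes, is the
    probability that the picked events hold and none of the smaller ones does,
    with positive sign, so the truncated sum is a lower bound; the credit
    balances the size of the kept sets ([brun_level]) against what is discarded
    ([brun_defect]). *)
Fixpoint brun (o : bool) (c : R) (s : seq I) : seq (seq I) :=
  if s is p :: s' then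
    brun o (c + v p) s' ++
    (if o && (c + v p - 1 < 0) then [::]
     else [seq p :: T | T <- brun (~~ o) (c + v p - 1) s'])
  else [:: [::]].

Lemma brun_cons_sum o c p s (F : seq I -> R) :
  \sum_(T <- brun o c (p :: s)) F T =
  \sum_(T <- brun o (c + v p) s) F T +
  (if o && (c + v p - 1 < 0) then 0
   else \sum_(T <- brun (~~ o) (c + v p - 1) s) F (p :: T)).
Proof.
by rewrite /= big_cat /=; case: ifP => _; rewrite ?big_nil ?big_map.
Qed.

Lemma brun_subseq o c s T : T \in brun o c s -> subseq T s.
Proof.
elim: s o c T => [|p s IH] o c T /=; first by rewrite inE => /eqP ->.
rewrite mem_cat => /orP[/IH TS|].
  exact: subseq_trans TS (subseq_cons _ _).
case: ifP => // _ /mapP[T' /IH T's ->]; by rewrite /= eqxx.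
Qed.

Lemma brun_uniq o c s : uniq s -> uniq (brun o c s).
Proof.
elim: s o c => [|p s IH] o c //= /andP[ps us].
rewrite cat_uniq IH //=; case: ifP => _ //=.
rewrite map_inj_uniq ?IH // ?andbT; last by move=> ? ? [].
apply/hasPn => _ /mapP[T _ ->]; apply/negP => /brun_subseq/mem_subseq sT.
by move: ps; rewrite (sT p) // mem_head.
Qed.

(** With [l p = ln p] and [M = ln y] this bounds the largest modulus of the
    sieve. The invariant is that the credit is at least [0] at even and at least
    [-1] at odd parity, so a pick of cost [l p] is always covered by the drop of
    [l p * (c + 1)], while the credit [v p] earned at [p] is worth at most
    [v p * l p] from there on because [l] decreases along the list. *)
Lemma brun_level (l : I -> R) o c s (M : R) (T : seq I) :
  (forall p, 0 <= l p) -> (forall p, 0 <= v p) ->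
  all (fun p => l p <= M) s -> sorted (fun p p' => l p' <= l p) s ->
  0 <= M -> (if o then - 1 else 0) <= c ->
  T \in brun o c s ->
  \sum_(p <- T) l p <= M * (c + 1) + \sum_(p <- s) v p * l p.
Proof.
move=> l0 v0; elim: s o c M T => [|p s IH] o c M T /=.
  rewrite inE => _ _ M0 c0 /eqP ->; rewrite !big_nil addr0 mulr_ge0 //.
  by case: o c0; lra.
move=> /andP[pM _] srt M0 c0.
have sp : all (fun p' => l p' <= l p) s.
  apply: order_path_min srt => a b d ab bd; exact: le_trans bd ab.
have srt' := path_sorted srt.
have lv := mulr_ge0 (v0 p) (l0 p).
have c1 : 0 <= c + 1 by case: o c0; lra.
have Mc : l p * (c + 1) <= M * (c + 1) by exact: ler_wpM2r.
rewrite big_cons mem_cat => /orP[Ts|].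
  have := IH o _ (l p) T sp srt' (l0 p) _ Ts.
  move=> /(_ _)/le_trans; apply; last by lra.
  by apply: le_trans c0 _; rewrite lerDl.
case: ifP => // oc /mapP[T' Ts ->]; rewrite big_cons.
have c' : (if ~~ o then -1 else 0) <= c + v p - 1.
  case: o c0 oc {Ts} => /= c0 oc; last by have := v0 p; lra.
  by rewrite leNgt oc.
have := IH (~~ o) _ (l p) T' sp srt' (l0 p) c' Ts; lra.
Qed.

(** For independent events of probability [q p] the relative error of the sieve
    is at most [exp (- c L)]. The hypothesis on [v] says that earning [v p]
    pays for the factor [1 - q p] and for the branch in which [p] is picked;
    at a refused pick the credit is negative, so the claimed relative
    error exceeds [1], and what is discarded is at most the whole. *)
Lemma brun_defect (q : I -> R) (L : R) o c s :
  (forall p, p \in s -> 0 <= q p <= 1) ->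
  (forall p, p \in s -> 1 + expR L * q p <= expR (v p * L) * (1 - q p)) ->
  0 <= L ->
  let V := \prod_(p <- s) (1 - q p) in
  let e := \sum_(T <- brun o c s) (-1) ^+ size T * \prod_(p <- T) q p in
  (-1) ^+ o * (V - e) <= expR (- (c * L)) * V.
Proof.
move=> q01 qv L0; elim: s o c q01 qv => [|p s IH] o c q01 qv /=.
  by rewrite big_nil big_seq1 /= big_nil expr0 mul1r subrr mulr0 mulr1 expR_ge0.
rewrite brun_cons_sum big_cons.
have {}IH o' c' := IH o' c' (fun p' ps => q01 p' (mem_behead (s := p :: s) ps))
                   (fun p' ps => qv p' (mem_behead (s := p :: s) ps)).
set V := \prod_(j <- s) _ in IH *.
pose e o' c' := \sum_(T <- brun o' c' s) (-1) ^+ size T * \prod_(p <- T) q p.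
have V0 : 0 <= V.
  rewrite /V big_seq; apply: prodr_ge0 => j js; rewrite subr_ge0.
  by case/andP: (q01 j (mem_behead (s := p :: s) js)).
have /andP[q0 q1] := q01 p (mem_head _ _).
rewrite -/(e _ _).
have -> : \sum_(T <- brun (~~ o) (c + v p - 1) s)
    (-1) ^+ size (p :: T) * \prod_(p <- (p :: T)) q p
    = - (q p * e (~~ o) (c + v p - 1)).
  rewrite /e mulr_sumr -sumrN; apply: eq_bigr => T _.
  by rewrite big_cons /= exprS; ring.
have step : (-1) ^+ o * (V - e o (c + v p)) + q p * (expR (- ((c + v p - 1) * L)) * V)
    <= expR (- (c * L)) * ((1 - q p) * V).
  apply: le_trans (lerD (IH o (c + v p)) (lexx _)) _.
  have := qv p (mem_head _ _); move=> /(ler_wpM2r V0) h.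
  have -> : - ((c + v p - 1) * L) = L + - (v p * L) + - (c * L) by ring.
  have -> : - ((c + v p) * L) = - (v p * L) + - (c * L) by ring.
  rewrite !expRD.
  have E0 : 0 <= expR (- (c * L)) * expR (- (v p * L)) by rewrite mulr_ge0 ?expR_ge0.
  have := ler_wpM2l E0 h.
  have EE : expR (- (v p * L)) * expR (v p * L) = 1 by rewrite -expRD addNr expR0.
  have -> : expR (- (c * L)) * expR (- (v p * L)) * (expR (v p * L) * (1 - q p) * V)
     = (expR (- (v p * L)) * expR (v p * L)) * (expR (- (c * L)) * ((1 - q p) * V)) by ring.
  by rewrite EE mul1r; apply: le_trans; rewrite le_eqVlt; apply/orP; left; apply/eqP; ring.
apply: le_trans step.
case: ifP => [/andP[] ot c1|oc].
  rewrite addr0 ot in IH *.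
  have : 1 <= expR (- ((c + v p - 1) * L)).
    by rewrite -{1}expR0 ler_expR oppr_ge0 mulr_le0_ge0 // ltW.
  move=> /(ler_wpM2l V0) /(ler_wpM2l q0).
  by rewrite expr1; lra.
have := ler_wpM2l q0 (IH (~~ o) (c + v p - 1)).
rewrite -/(e _ _) => h.
have -> : (-1) ^+ o = - (-1) ^+ (~~ o)%B :> R by case: (o); rewrite /= ?expr1 ?expr0 ?opprK.
by move: h; rewrite /=; lra.
Qed.

End BrunSieve.

Lemma fine_measure_setIC (R : realType) d (T : measurableType d)
    (P : probability T R) (S B : set T) : measurable S -> measurable B ->
  fine (P S) = fine (P (S `&` B)) + fine (P (S `&` ~` B)).
Proof.
move=> mS mB; rewrite -fineD ?fin_num_measure //; last 2 first.
- exact: measurableI.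
- by apply: measurableI => //; exact: measurableC.
rewrite -measureU.
- by rewrite -setIUr setUv setIT.
- exact: measurableI.
- by apply: measurableI => //; exact: measurableC.
- by rewrite setIACA setICr setI0.
Qed.

(** Bonferroni's argument along the list: splitting on the first event expresses
    both sides through the shorter list with opposite parities, and a refused
    pick only drops a nonnegative probability. *)
Lemma brun_lower_bound (R : realType) d (T : measurableType d)
    (P : probability T R) (I : eqType) (v : I -> R) (C : I -> set T)
    (o : bool) (c : R) (s : seq I) (B : set T) :
  (forall p, measurable (C p)) -> measurable B ->
  0 <= (-1) ^+ o * (fine (P (B `&` \big[setI/setT]_(p <- s) ~` C p)) -
    \sum_(J <- brun v o c s)
      (-1) ^+ size J * fine (P (B `&` \big[setI/setT]_(p <- J) C p))).
Proof.
move=> mC; elim: s o c B => [|p s IH] o c B mB.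
  by rewrite /= !big_nil big_seq1 big_nil expr0 mul1r subrr mulr0.
rewrite brun_cons_sum big_cons.
have mD : measurable (B `&` \big[setI/setT]_(p <- s) ~` C p).
  by apply: measurableI => //; apply: bigsetI_measurable => i _; exact: measurableC.
have E : fine (P (B `&` (~` C p `&` \big[setI/setT]_(p <- s) ~` C p))) =
    fine (P (B `&` \big[setI/setT]_(p <- s) ~` C p)) -
    fine (P (B `&` C p `&` \big[setI/setT]_(p <- s) ~` C p)).
  by rewrite (fine_measure_setIC P mD (mC p)) setIAC addrAC subrr add0r
     setIA setIAC.
rewrite {}E.
set e1 := \sum_(J <- brun _ _ _ _) _.
have h1 := IH o (c + v p) B mB; rewrite -/e1 in h1.
have h0 : 0 <= fine (P (B `&` C p `&` \big[setI/setT]_(p <- s) ~` C p)).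
  by rewrite fine_ge0.
case: ifP => [/andP[] ot c1|_].
  by move: h1 h0; rewrite addr0 ot expr1; lra.
have h2 := IH (~~ o) (c + v p - 1) (B `&` C p) (measurableI _ _ mB (mC p)).
under [X in e1 + X]eq_bigr => J _ do rewrite big_cons exprS setIA -mulrA mulN1r.
rewrite sumrN.
move: h1 h2 h0; set e2 := \sum_(J <- brun _ (~~ o) _ _) _.
by case: (o); rewrite /= ?expr1 ?expr0; lra.
Qed.

(** * Vectors of exponents indexed by the primes up to [y] *)

Lemma fact_leq_expn n : (n`! <= n ^ n)%N.
Proof.
elim: n => // n IH; rewrite factS expnS leq_mul2l /=.
by apply: leq_trans IH _; case: n => // n; rewrite leq_exp2r.
Qed.

Lemma ln_prod (R : realType) (J : Type) (s : seq J) (F : J -> R) :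
  (forall j, 0 < F j) -> ln (\prod_(j <- s) F j) = \sum_(j <- s) ln (F j).
Proof.
move=> F0; elim: s => [|j s IH]; first by rewrite !big_nil ln1.
by rewrite !big_cons lnM ?IH // posrE // prodr_gt0.
Qed.

Section PrimeVectors.
Context {R : realType} {y : R}.
Local Notation I := (primes_upto y).
Implicit Types (F : I -> nat) (p q : I) (n : nat).

Lemma prime_valP p : prime p.
Proof. exact: (valP p). Qed.

Lemma prime_val_inj : injective (@prime_val R y).
Proof. by move=> p q /val_inj/val_inj. Qed.

Lemma prime_val_le p : 0 <= y -> p%:R <= y.
Proof.
move=> y0; rewrite -truncn_ge_nat //; have := ltn_ord (val p).
by rewrite ltnS.
Qed.

Definition prime_vector_prod F : nat := (\prod_(p : I) p ^ F p)%N.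
Local Notation N := prime_vector_prod.

Lemma prime_vector_prod_gt0 F : (0 < N F)%N.
Proof. by apply: prodn_gt0 => p; rewrite expn_gt0 prime_gt0 ?prime_valP. Qed.

Lemma coprime_prime_val p q a b : p != q -> coprime (p ^ a) (q ^ b).
Proof.
move=> pq; apply/coprimeXl/coprimeXr.
by rewrite prime_coprime ?prime_valP // dvdn_prime2 ?prime_valP.
Qed.

Lemma logn_prime_vector_prod F p : logn p (N F) = F p.
Proof.
rewrite /N (bigD1 p) //= mulnC logn_Gauss ?pfactorK ?prime_valP //.
rewrite -[X in coprime X _]expn1.
elim/big_rec: _ => [|q m qp]; first exact: coprimen1.
by move=> h; rewrite coprimeMr h andbT coprime_prime_val // eq_sym.
Qed.

Lemma prime_vector_prod_dvd F n : (0 < n)%N ->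
  (N F %| n)%N = [forall p : I, (F p <= logn p n)%N].
Proof.
move=> n0; apply/unstable.Gauss_dvd_prod/forallP => [|h p|h p _ _].
- rewrite filter_predT; apply/(pairwiseP 0%N) => i j.
  rewrite !inE size_map => ilt jlt ij.
  have x0 : I by case: (index_enum _) ilt.
  rewrite !(nth_map x0) //; apply: coprime_prime_val.
  by rewrite nth_uniq ?index_enum_uniq // neq_ltn ij.
- by rewrite -pfactor_dvdn ?prime_valP //; apply: h => //; rewrite mem_index_enum.
- by rewrite pfactor_dvdn ?prime_valP.
Qed.

Lemma prime_dvd_prime_vector_prod F n : prime n -> (n %| N F)%N ->
  exists2 p, prime_val p = n & (0 < F p)%N.
Proof.
move=> pn; rewrite /N; elim/big_rec: _ => [|p m _ IH].
  by rewrite dvdn1 => /eqP n1; rewrite n1 in pn.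
rewrite Euclid_dvdM // => /orP[|//]; rewrite Euclid_dvdX //.
move=> /andP[]; rewrite dvdn_prime2 ?prime_valP // => /eqP np F0.
by exists p.
Qed.

Lemma max_pdiv_prime_vector_prod F : 1 <= y -> (max_pdiv (N F))%:R <= y.
Proof.
move=> y1; have [N1|N1] := leqP (N F) 1.
  have -> : N F = 1%N by apply/eqP; rewrite eqn_leq N1 prime_vector_prod_gt0.
  by [].
have [p <- _] := prime_dvd_prime_vector_prod (max_pdiv_prime N1) (max_pdiv_dvd _).
by apply: prime_val_le; apply: le_trans y1.
Qed.

Lemma totient_prime_vector_prod F : totient (N F) = (\prod_(p : I) totient (p ^ F p))%N.
Proof.
rewrite /N; have : uniq (index_enum I) by exact: index_enum_uniq.
elim: (index_enum I) => [|p s IH] /=; first by rewrite !big_nil.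
move=> /andP[ps us]; rewrite !big_cons totient_coprime ?IH //.
elim: s ps {IH us} => [|q s IH]; first by rewrite big_nil coprimen1.
rewrite inE negb_or => /andP[pq /IH h].
by rewrite big_cons coprimeMr h andbT coprime_prime_val.
Qed.

Lemma card_prime_dvd n : (0 < n)%N ->
  (#|[set p : I | (p : nat) %| n]%SET| <= size (primes n))%N.
Proof.
move=> n0; rewrite cardE -(size_map (@prime_val R y)).
apply: uniq_leq_size; first by rewrite map_inj_uniq ?enum_uniq //; exact: prime_val_inj.
move=> x /mapP[p]; rewrite mem_enum inE => pn ->.
by rewrite mem_primes prime_valP n0.
Qed.

(** Chebyshev's argument: with [n] the integer part of [y], the product of the
    [p ^ (n %/ p)] divides [n!], hence is at most [n ^ n], and
    [n %/ p >= n / (2 p)]. *)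
Lemma sum_ln_prime_le : 1 <= y -> \sum_(p : I) ln p%:R / p%:R <= 2 * ln y.
Proof.
move=> y1; set n := Num.truncn y.
have y0 : 0 <= y by lra.
have n0 : (0 < n)%N by rewrite truncn_gt0.
have ny : n%:R <= y by rewrite truncn_le.
have lnn : ln n%:R <= ln y by rewrite ler_ln ?posrE ?ltr0n //; lra.
have p0 p : 0 < p%:R :> R by rewrite ltr0n prime_gt0 ?prime_valP.
have lnp p : 0 <= ln p%:R :> R by rewrite ln_ge0 // ler1n prime_gt0 ?prime_valP.
have step : \sum_(p : I) (n %/ p)%N%:R * ln p%:R <= n%:R * ln n%:R :> R.
  have h : (N (fun p => n %/ p) <= n ^ n)%N.
    apply: leq_trans (fact_leq_expn n).
    apply: dvdn_leq; first exact: fact_gt0.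
    rewrite prime_vector_prod_dvd ?fact_gt0 //; apply/forallP => p.
    rewrite logn_fact ?prime_valP // big_ltn // expn1; exact: leq_addr.
  have : (N (fun p => n %/ p)%N)%:R <= (n ^ n)%N%:R :> R by rewrite ler_nat.
  rewrite -ler_ln ?posrE ?ltr0n ?expn_gt0 ?n0 ?prime_vector_prod_gt0 //.
  rewrite natrX lnXn ?ltr0n // -[_ *+ n]mulr_natl.
  move=> h2; apply: le_trans h2.
  rewrite /N natr_prod ln_prod; last by move=> p; rewrite ltr0n expn_gt0 prime_gt0 ?prime_valP.
  by apply: ler_sum => p _; rewrite natrX lnXn // mulr_natl.
have nR : 0 < n%:R :> R by rewrite ltr0n.
apply: le_trans (_ : 2 * ln n%:R <= _); last by lra.
rewrite -(ler_pM2l nR) mulrCA; apply: le_trans (ler_wpM2l _ step) => //.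
rewrite !mulr_sumr; apply: ler_sum => p _.
rewrite !mulrA [_ * ln _]mulrC -[ln _ * _ * _]mulrA [_ * ln _]mulrC ler_wpM2l //.
rewrite ler_pdivrMr // -!natrM ler_nat.
have pn : (prime_val p <= n)%N by have := ltn_ord (val p); rewrite ltnS.
have := divn_eq n (prime_val p); have := ltn_mod n (prime_val p); have : (0 < n %/ prime_val p)%N by rewrite divn_gt0 // prime_gt0 ?prime_valP.
have := prime_gt0 (prime_valP p); nia.
Qed.
End PrimeVectors.

(** * The independent model and its moments *)

Lemma totient1 : totient 1 = 1%N.
Proof. by []. Qed.

Section Model.
Context {R : realType} (a : int).

(** The probability that the model exponent of [p] is at least [k]. *)
Definition tail (p k : nat) : R :=
  if (p%:Z %| a)%Z then (k == 0%N)%:R else (totient (p ^ k))%:R^-1.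

Definition pmass (p k : nat) : R := tail p k - tail p k.+1.

Lemma tail0 p : tail p 0 = 1.
Proof. by rewrite /tail; case: ifP => // _; rewrite expn0 totient1 invr1. Qed.

Lemma tail_ge0 p k : 0 <= tail p k.
Proof. by rewrite /tail; case: ifP => _; rewrite ?invr_ge0 ?ler0n. Qed.

Lemma tailS_le p k : prime p -> tail p k.+1 <= 2 / p%:R * (p ^ k)%N%:R^-1.
Proof.
move=> pp; have p1 := prime_gt1 pp.
rewrite /tail; case: ifP => _ /=; first by rewrite mulr_ge0 ?divr_ge0 ?invr_ge0 ?ler0n.
rewrite totient_pfactor //= natrM invfM ler_wpM2r ?invr_ge0 ?ler0n //.
rewrite ler_pdivlMr ?ltr0n ?prime_gt0 // mulrC ler_pdivrMr ?ltr0n; last lia.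
rewrite -natrM ler_nat; lia.
Qed.

Lemma pmass_ge0 p k : prime p -> 0 <= pmass p k.
Proof.
move=> pp; have p1 := prime_gt1 pp; rewrite /pmass /tail subr_ge0; case: ifP => _.
  by case: k => //= _; rewrite ler0n.
rewrite lef_pV2 ?posrE ?ltr0n ?totient_gt0 ?expn_gt0 ?prime_gt0 // ler_nat.
case: k => [|k]; first by rewrite expn0 totient1 totient_gt0 expn_gt0 prime_gt0.
by rewrite !totient_pfactor //= leq_pmul2l ?leq_exp2l //; lia.
Qed.

(** Given that [p] occurs at least [k] times, the probability of one more
    occurrence. Where the mass at [k] vanishes this ratio may be [1], as for
    [p = 2] and [k = 0] with [a] odd, and there the sieve would break down;
    vectors of mass zero are therefore treated apart. *)
Lemma tail_ratio p k : prime p -> pmass p k != 0 ->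
  [/\ 0 < tail p k, tail p k.+1 / tail p k <= 2^-1
    & tail p k.+1 / tail p k <= 2 / p%:R].
Proof.
move=> pp; have p1 := prime_gt1 pp.
have pR : 0 < p%:R :> R by rewrite ltr0n prime_gt0.
rewrite /pmass /tail; case: ifP => _ /=.
  by case: k => [|k] /=; rewrite ?subrr ?eqxx // mul0r divr_ge0 ?ler0n.
case: k => [|k].
  rewrite expn0 expn1 totient1 totient_prime // invr1 divr1 => h.
  have p3 : (2 < p)%N.
    by rewrite ltn_neqAle p1 andbT; apply: contra h => /eqP <-; rewrite invr1 subrr.
  split=> //; first by rewrite lef_pV2 ?posrE ?ltr0n ?ler_nat; lia.
  rewrite ler_pdivlMr // mulrC ler_pdivrMr ?ltr0n; last lia.
  rewrite -natrM ler_nat; lia.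
have k0 j : 0 < (p ^ j)%N%:R :> R by rewrite ltr0n expn_gt0 prime_gt0.
have pm : 0 < (p.-1)%:R :> R by rewrite ltr0n; lia.
move=> _; rewrite !totient_pfactor //= invrK.
rewrite expnS !natrM.
have -> : (p.-1%:R * (p%:R * (p ^ k)%N%:R))^-1 * (p.-1%:R * (p ^ k)%N%:R) = p%:R^-1 :> R.
  by field; rewrite !gt_eqF //= k0.
split.
- by rewrite invr_gt0 mulr_gt0.
- by rewrite lef_pV2 ?posrE // ler_nat.
- by rewrite ler_peMl ?invr_ge0 ?ler0n // ler1n.
Qed.

Lemma sum_pmass p K : \sum_(k < K) pmass p k = 1 - tail p K.
Proof.
elim: K => [|K IH]; first by rewrite big_ord0 tail0 subrr.
by rewrite big_ord_recr /= IH /pmass; ring.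
Qed.

(** Summation by parts turns the moment into a sum of tails, which decay like
    [p ^ (- k)]; the factor [E - 1] makes the bound summable over the primes. *)
Lemma pmass_moment_le p K (E rho : R) : prime p -> 1 <= E -> E / p%:R <= rho -> rho < 1 ->
  \sum_(k < K.+1) pmass p k * E ^+ k <= 1 + (E - 1) * (2 / p%:R) * (1 - rho)^-1.
Proof.
move=> pp E1 Er r1.
have pR : 0 < p%:R :> R by rewrite ltr0n prime_gt0.
(* The boundary term of the summation by parts is kept on the left: it is nonnegative. *)
have abel : \sum_(k < K.+1) pmass p k * E ^+ k + tail p K.+1 * E ^+ K
    = 1 + (E - 1) * \sum_(k < K) tail p k.+1 * E ^+ k.
  elim: K => [|K IH].
    by rewrite big_ord1 big_ord0 /pmass !expr0 mulr0 addr0 !mulr1 tail0 subrK.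
  rewrite big_ord_recr [in RHS]big_ord_recr /= mulrDr addrA -IH /pmass exprS; ring.
have E0 : 0 <= E - 1 by lra.
have t0 : 0 <= tail p K.+1 * E ^+ K by rewrite mulr_ge0 ?tail_ge0 ?exprn_ge0 //; lra.
have geo n : \sum_(k < n) rho ^+ k <= (1 - rho)^-1.
  have r0 : 0 <= rho by apply: le_trans Er; rewrite divr_ge0 ?ltW //; lra.
  rewrite -div1r ler_pdivlMr ?subr_gt0 // mulrC.
  have := subrX1 rho n => h.
  have -> : (1 - rho) * \sum_(k < n) rho ^+ k = 1 - rho ^+ n by rewrite -opprB mulNr -h; ring.
  by rewrite gerBl exprn_ge0.
have : \sum_(k < K) tail p k.+1 * E ^+ k <= 2 / p%:R * (1 - rho)^-1.
  apply: le_trans (ler_wpM2l _ (geo K)); last by rewrite divr_ge0 ?ltW.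
  rewrite mulr_sumr; apply: ler_sum => k _.
  have Ek : 0 <= E ^+ k by rewrite exprn_ge0 //; lra.
  apply: le_trans (ler_wpM2r Ek (tailS_le k pp)) _.
  have c0 : 0 <= 2 / p%:R :> R by rewrite divr_ge0 // ltW.
  move: (2 / _) c0 => b b0; rewrite -mulrA ler_wpM2l // natrX -exprVn -exprMn mulrC.
  have Ep0 : 0 <= E / p%:R by rewrite divr_ge0 ?ltW //; lra.
  by rewrite lerXn2r ?nnegrE // (le_trans Ep0).
move=> /(ler_wpM2l E0); lra.
Qed.

End Model.

(** The convex function [expR (s * x) - 1] vanishes at [0], so it lies below its
    chord on [0, t]. *)
Lemma expR_chord (R : realType) (s t x : R) : 0 <= s -> 0 < t -> 0 <= x <= t ->
  expR (s * x) - 1 <= x / t * (expR (s * t) - 1).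
Proof.
move=> s0 t0 /andP[x0 xt].
have l0 : 0 <= x / t by rewrite divr_ge0 // ltW.
have l1 : x / t <= 1 by rewrite ler_pdivrMr // mul1r.
have := convex_expR (Itv01 l0 l1) (s * t) 0.
rewrite !convRE /= expR0 /unstable.onem mulr0 addr0 mulr1.
have -> : x / t * (s * t) = s * x by field; rewrite gt_eqF.
by lra.
Qed.

Section Moment.
Context {R : realType} {y : R} (a : int).
Local Notation I := (primes_upto y).

Lemma sum_box_prod K (g : I -> nat -> R) :
  \sum_(f : {ffun I -> 'I_K}) \prod_(p : I) g p (f p) =
  \prod_(p : I) \sum_(k < K) g p k.
Proof. by rewrite bigA_distr_bigA. Qed.

(** The moment used in Rankin's trick. By [expR_chord] the local factor at [p]
    contributes at most a constant times [y ^ sigma / ln y * (ln p / p)], and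
    [sum_ln_prime_le] sums this to a multiple of [y ^ sigma]. *)
Lemma model_moment_le K (sigma e : R) : 2 <= y -> 0 <= sigma -> 0 < e -> sigma <= 1 - e ->
  \sum_(f : {ffun I -> 'I_K.+1}) (\prod_(p : I) pmass a p (f p)) *
     expR (sigma * ln (prime_vector_prod (fun p : I => f p : nat))%:R)
  <= expR (4 / (1 - expR (- (e * ln 2))) * expR (sigma * ln y)).
Proof.
move=> y2 s0 e0 s1; set rho := expR (- _).
have ln2 : 0 < ln 2 :> R by rewrite ln_gt0 // ltr1n.
have lny : 0 < ln y by rewrite ln_gt0 //; lra.
have r1 : rho < 1 by rewrite -expR0 ltr_expR oppr_lt0 mulr_gt0.
pose E (p : I) := expR (sigma * ln (p : nat)%:R) : R.
have -> : \sum_(f : {ffun I -> 'I_K.+1}) (\prod_(p : I) pmass a p (f p)) *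
     expR (sigma * ln (prime_vector_prod (fun p : I => f p : nat))%:R)
   = \sum_(f : {ffun I -> 'I_K.+1}) \prod_(p : I) (pmass a p (f p) * E p ^+ (f p)).
  apply: eq_bigr => f _; rewrite big_split /=; congr (_ * _).
  rewrite /prime_vector_prod natr_prod ln_prod; last first.
    by move=> p; rewrite ltr0n expn_gt0 prime_gt0 ?prime_valP.
  rewrite mulr_sumr expR_sum; apply: eq_bigr => p _.
  rewrite natrX lnXn ?ltr0n ?prime_gt0 ?prime_valP // /E -expRM_natl; congr expR.
  by rewrite -[ln _ *+ _]mulr_natl mulrCA.
rewrite (@sum_box_prod _ (fun p k => pmass a p k * E p ^+ k)).
have lp0 (p : I) : 0 <= ln (p : nat)%:R :> R by rewrite ln_ge0 // ler1n prime_gt0 ?prime_valP.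
have pR (p : I) : 0 < (p : nat)%:R :> R by rewrite ltr0n prime_gt0 ?prime_valP.
have k0 : 0 <= (1 - rho)^-1 by rewrite invr_ge0 subr_ge0 ltW.
pose c (p : I) := ln (p : nat)%:R / ln y * (expR (sigma * ln y) - 1) * (2 / (p : nat)%:R) * (1 - rho)^-1.
have le1 (p : I) : 0 <= \sum_(k < K.+1) pmass a p k * E p ^+ k <= expR (c p).
  apply/andP; split.
    by apply: sumr_ge0 => k _; rewrite mulr_ge0 ?pmass_ge0 ?prime_valP ?exprn_ge0 ?expR_ge0.
  have h1 : 1 <= E p by rewrite -expR0 ler_expR mulr_ge0.
  have h2 : E p / (p : nat)%:R <= rho.
    rewrite -[X in _ / X](lnK) ?posrE // -expRN -expRD ler_expR.
    have : ln 2 <= ln (p : nat)%:R :> R by rewrite ler_ln ?posrE // ler_nat prime_gt1 ?prime_valP.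
    nra.
  apply: le_trans (pmass_moment_le a K (prime_valP p) h1 h2 r1) _.
  apply: le_trans (expR_ge1Dx _); rewrite lerD2l /c !ler_wpM2r //.
  apply: expR_chord => //; rewrite lp0 /= ler_ln ?posrE //; last lra.
  by apply: prime_val_le; lra.
apply: (@le_trans _ _ (\prod_(p : I) expR (c p))); first by apply: ler_prod => p _; exact: le1.
rewrite -expR_sum ler_expR /c -!mulr_suml.
have -> : \sum_(p : I) ln (p : nat)%:R / ln y * (expR (sigma * ln y) - 1) * (2 / (p : nat)%:R)
  = (expR (sigma * ln y) - 1) * 2 / ln y * \sum_(p : I) ln (p : nat)%:R / (p : nat)%:R.
  rewrite mulr_sumr; apply: eq_bigr => p _; ring.
rewrite [leRHS]mulrAC ler_wpM2r //.
have E1 : 0 <= expR (sigma * ln y) - 1 by rewrite subr_ge0 -expR0 ler_expR mulr_ge0 // ltW.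
have := @sum_ln_prime_le R y; move=> /(_ ltac:(lra)) h.
have E2 : 0 <= (expR (sigma * ln y) - 1) * 2 / ln y by rewrite divr_ge0 ?mulr_ge0 // ltW.
have h2 := ler_wpM2l E2 h.
apply: le_trans h2 _.
have -> : (expR (sigma * ln y) - 1) * 2 / ln y * (2 * ln y) = 4 * (expR (sigma * ln y) - 1).
  by field; rewrite gt_eqF.
by rewrite ler_wpM2l //; lra.
Qed.
End Moment.

(** * The sieve applied to the model *)

Section Pointwise.
Context {R : realType} {y : R} (a : int).
Local Notation I := (primes_upto y).
Local Notation N := prime_vector_prod.

(** The exponents of the product of the primes in [J] and of the integer with
    exponents [f]. *)
Definition shift (f : I -> nat) (J : {set I}) (p : I) : nat := (f p + (p \in J))%N.

(** The probability that [n] divides the random integer of the model. *)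
Definition ptail (n : nat) : R :=
  if gcdz n a == 1 then (totient n)%:R^-1 else 0.

Lemma prod_tail (F : I -> nat) : \prod_(p : I) tail a p (F p) = ptail (N F).
Proof.
rewrite /ptail; case: eqP => [g1|g1].
  rewrite totient_prime_vector_prod natr_prod -prodfV; apply: eq_bigr => p _.
  rewrite /tail; case: ifP => // pa.
  case E: (F p) => [|k]; first by rewrite expn0 totient1 invr1.
  exfalso; have : ((prime_val p)%:Z %| gcdz (N F) a)%Z.
    rewrite dvdz_gcd pa andbT /dvdz /= .
    rewrite /prime_vector_prod (bigD1 p) //= E expnS -mulnA; exact: dvdn_mulr.
  rewrite g1 dvdz1 /= => /eqP p1; have := prime_valP p.
  by rewrite p1.
have N0 := prime_vector_prod_gt0 F.
have G1 : (1 < gcdn (N F) `|a|)%N.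
  rewrite ltn_neqAle gcdn_gt0 N0 /= andbT; apply/eqP => h; apply: g1.
  by rewrite /gcdz /= -h.
have := pdiv_dvd (gcdn (N F) `|a|); rewrite dvdn_gcd => /andP[d1 d2].
have [p pE F0] := prime_dvd_prime_vector_prod (pdiv_prime G1) d1.
have pa : ((prime_val p)%:Z %| a)%Z by rewrite pE; exact: d2.
rewrite (bigD1 p) //= /tail pa.
by rewrite eqn0Ngt F0 mul0r.
Qed.

Lemma prod_shift (f : I -> nat) (J : {set I}) :
  N (shift f J) = (N f * \prod_(p in J) prime_val p)%N.
Proof.
rewrite /prime_vector_prod [X in (_ * X)%N]big_mkcond -big_split /=.
by apply: eq_bigr => p _; rewrite /shift expnD; case: (p \in J); rewrite ?expn1 ?expn0.
Qed.

Definition desc_primes : seq I := sort (fun p q : I => (q <= p)%N) (enum {: I}).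

Lemma desc_primes_uniq : uniq desc_primes.
Proof. by rewrite sort_uniq enum_uniq. Qed.

Lemma desc_primes_big (T : Type) (x : T) (op : Monoid.com_law x) (F : I -> T) :
  \big[op/x]_(p <- desc_primes) F p = \big[op/x]_p F p.
Proof.
rewrite -[RHS]big_enum /=; apply: perm_big; by rewrite perm_sort.
Qed.

Lemma big_seq_finset (T : Type) (x : T) (op : Monoid.com_law x) (F : I -> T) (J : seq I) :
  uniq J -> \big[op/x]_(p <- J) F p = \big[op/x]_(p in [set p in J]%SET) F p.
Proof.
by move=> uJ; rewrite big_uniq //=; apply: eq_bigl => p; rewrite inE.
Qed.

Context (L : R).
(** By [tail_ratio] the conditional probabilities are at most [1/2] and [2 / p]
    at vectors of nonzero mass, and under these bounds this weight satisfies the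
    hypothesis of [brun_defect] for the parameter [L]; by [sum_ln_prime_le] it
    raises the logarithm of the level by at most [ln y * brun_weight_level]. *)
Definition brun_weight (p : I) : R := 2 * (expR L + 2) / L / (prime_val p)%:R.
Definition brun_weight_level : R := 4 * (expR L + 2) / L.

Local Notation brun0 := (brun brun_weight false).

Lemma brun_desc_uniq b J : J \in brun0 b desc_primes -> uniq J.
Proof. by move=> /brun_subseq/subseq_uniq; apply; exact: desc_primes_uniq. Qed.

(** Given that the vector is at least [f], the events that it exceeds [f] at [p]
    are independent, so the sieve for the event that it equals [f] is that of
    [brun_defect] multiplied by the product of the tails. *)
Lemma model_defect (f : I -> nat) (b : R) : 0 < L ->
  \prod_(p : I) pmass a p (f p) != 0 :> R ->
  \prod_(p : I) pmass a p (f p) -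
   \sum_(J <- brun0 b desc_primes) (-1) ^+ size J * ptail (N (shift f [set p in J]%SET))
  <= expR (- (b * L)) * \prod_(p : I) pmass a p (f p).
Proof.
move=> L0 /prodf_neq0 nz.
have nz' (p : I) : pmass a p (f p) != 0 :> R by exact: nz.
pose q (p : I) := tail a p (f p).+1 / tail a p (f p) : R.
have tr (p : I) := tail_ratio (prime_valP p) (nz' p).
have t0 (p : I) : tail a p (f p) != 0 :> R by rewrite gt_eqF //; case: (tr p).
have q0 (p : I) : 0 <= q p by rewrite divr_ge0 ?tail_ge0.
have qh (p : I) : q p <= 2^-1 by case: (tr p).
have qp (p : I) : q p <= 2 / (prime_val p)%:R by case: (tr p).
set H := \prod_(p : I) tail a p (f p) : R.
have H0 : 0 <= H by apply: prodr_ge0 => p _; exact: tail_ge0.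
have massE : \prod_(p : I) pmass a p (f p) = H * \prod_(p <- desc_primes) (1 - q p).
  rewrite desc_primes_big -big_split /=; apply: eq_bigr => p _.
  by rewrite /pmass /q; field; exact: t0.
have sumE : \sum_(J <- brun0 b desc_primes) (-1) ^+ size J * ptail (N (shift f [set p in J]%SET))
   = H * \sum_(J <- brun0 b desc_primes) (-1) ^+ size J * \prod_(p <- J) q p.
  rewrite mulr_sumr; apply: eq_big_seq => J /brun_desc_uniq uJ.
  rewrite mulrCA; congr (_ * _); rewrite -prod_tail [X in _ = _ * X]big_seq_finset //.
  rewrite [X in _ * X]big_mkcond /H -big_split /=; apply: eq_bigr => p _.
  rewrite /shift; case: ifP => _; last by rewrite addn0 mulr1.
  by rewrite addn1 /q mulrC divfK.
have := @brun_defect R _ brun_weight q L false b desc_primes _ _ (ltW L0).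
rewrite /= expr0 mul1r massE sumE -mulrBr => h.
rewrite [leRHS]mulrCA ler_wpM2l // h // => p _.
  by rewrite q0 /=; have := qh p; lra.
rewrite /brun_weight.
have pR : 0 < (prime_val p)%:R :> R by rewrite ltr0n prime_gt0 ?prime_valP.
have -> : 2 * (expR L + 2) / L / (prime_val p)%:R * L = (expR L + 2) * (2 / (prime_val p)%:R).
  by field; rewrite !gt_eqF.
apply: (@le_trans _ _ (expR ((expR L + 2) * q p) * (1 - q p))); last first.
  rewrite ler_wpM2r //; first by have := qh p; lra.
  by rewrite ler_expR ler_wpM2l // addr_ge0 ?expR_ge0.
rewrite mulrDl expRD.
have e1 := expR_ge1Dx (expR L * q p).
have e2 : 1 <= expR (2 * q p) * (1 - q p).
  apply: le_trans (_ : (1 + 2 * q p) * (1 - q p) <= _).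
    have := q0 p; have := qh p; nra.
  rewrite ler_wpM2r ?expR_ge1Dx //; have := qh p; lra.
rewrite -mulrA; apply: le_trans e1 _.
by rewrite ler_peMr ?expR_ge0.
Qed.

Lemma brun_product_le (f : I -> nat) (b : R) (J : seq I) : 2 <= y -> 0 < L -> 0 <= b ->
  J \in brun0 b desc_primes ->
  ln (N (shift f [set p in J]%SET))%:R <= ln (N f)%:R + ln y * (b + 1 + brun_weight_level).
Proof.
move=> y2 L0 b0 Jb.
have pR (p : I) : 0 < (prime_val p)%:R :> R by rewrite ltr0n prime_gt0 ?prime_valP.
have lp0 (p : I) : 0 <= ln (prime_val p)%:R :> R by rewrite ln_ge0 // ler1n prime_gt0 ?prime_valP.
have NR F : 0 < (N F)%:R :> R by rewrite ltr0n prime_vector_prod_gt0.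
have E0 : 0 <= 2 * (expR L + 2) / L.
  by rewrite divr_ge0 ?mulr_ge0 ?addr_ge0 ?expR_ge0 // ltW.
rewrite prod_shift natrM lnM ?posrE //; last first.
  by rewrite ltr0n prodn_cond_gt0 // => p _; rewrite prime_gt0 ?prime_valP.
rewrite lerD2l -(@big_seq_finset _ _ muln) ?(brun_desc_uniq Jb) // natr_prod ln_prod //.
have l0 : 0 <= ln y by rewrite ln_ge0 //; lra.
have := @brun_level R _ brun_weight (fun p => ln (prime_val p)%:R) false b desc_primes (ln y) J lp0.
move=> /(_ _ _ _ l0 b0 Jb)/le_trans; apply.
- by move=> p; rewrite /brun_weight divr_ge0 // ltW.
- apply/allP => p _; rewrite ler_ln ?posrE //; last lra.
  by apply: prime_val_le; lra.
- have : sorted (fun p q : I => (q <= p)%N) desc_primes.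
    by apply: sort_sorted => p q; exact: leq_total.
  by apply: sub_sorted => p q pq; rewrite ler_ln ?posrE // ler_nat.
rewrite [in leRHS]mulrDr lerD2l desc_primes_big.
have -> : \sum_(p : I) brun_weight p * ln (prime_val p)%:R
   = 2 * (expR L + 2) / L * \sum_(p : I) ln (prime_val p)%:R / (prime_val p)%:R.
  by rewrite mulr_sumr; apply: eq_bigr => p _; rewrite /brun_weight; ring.
have := @sum_ln_prime_le R y; move=> /(_ ltac:(lra)) /(ler_wpM2l E0) h.
by apply: le_trans h _; rewrite /brun_weight_level le_eqVlt; apply/orP; left; apply/eqP; ring.
Qed.

End Pointwise.

(** * Summation over all exponent vectors *)

Section Counting.
Context {R : realType} {y : R}.
Local Notation I := (primes_upto y).
Local Notation N := prime_vector_prod.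

Lemma shift_inj (f g : I -> nat) (J : {set I}) :
  N (shift f J) = N (shift g J) -> f =1 g.
Proof.
move=> h p; have := logn_prime_vector_prod (shift f J) p.
by rewrite h logn_prime_vector_prod /shift => /addIn.
Qed.

(** The set [J] consists of prime divisors of [n], and [n] and [J] together
    determine [f]. *)
Lemma card_shift K n : (0 < n)%N ->
  (#|[set fJ : {ffun I -> 'I_K} * {set I} |
      N (shift (fun p => fJ.1 p : nat) fJ.2) == n]%SET| <= 2 ^ size (primes n))%N.
Proof.
move=> n0; set S := [set fJ | _]%SET.
have inj : {in S &, injective (fun fJ : {ffun I -> 'I_K} * {set I} => fJ.2)}.
  move=> [f J] [g J']; rewrite !inE /= => /eqP hf /eqP hg JJ.
  move: hg; rewrite -JJ -hf => /shift_inj h; congr pair.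
  by apply/ffunP => p; apply: val_inj; rewrite /= h.
rewrite -(card_in_imset inj).
apply: leq_trans (_ : 2 ^ #|[set p : I | prime_val p %| n]%SET| <= _)%N; last first.
  by rewrite leq_exp2l // card_prime_dvd.
rewrite -card_powerset; apply/subset_leq_card/fintype.subsetP => J /imsetP[[f J'] + ->].
rewrite !inE /= => /eqP <-; apply/fintype.subsetP => p pJ.
rewrite inE prod_shift dvdn_mull // (bigD1 p) //=; exact: dvdn_mulr.
Qed.

(** This is where the weight [2 ^ omega(n)] of the final estimate arises. *)
Lemma sum_shift_le K M (g : nat -> R) : 1 <= y -> (forall n, 0 <= g n) ->
  \sum_(f : {ffun I -> 'I_K})
    \sum_(J : {set I} | (N (shift (fun p : I => f p : nat) J) <= M)%N)
      g (N (shift (fun p : I => f p : nat) J))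
  <= \sum_(1 <= n < M.+1 | (max_pdiv n)%:R <= y) g n * (2 ^ size (primes n))%N%:R.
Proof.
move=> y1 g0; rewrite pair_big_dep /=.
set N' := fun fJ : {ffun I -> 'I_K} * {set I} => N (shift (fun p => fJ.1 p : nat) fJ.2).
rewrite -/(N' _).
apply: (@le_trans _ _ (\sum_(fJ | (N' fJ <= M)%N)
    \sum_(1 <= n < M.+1 | (max_pdiv n)%:R <= y) g n * (N' fJ == n)%:R)).
  apply: ler_sum => fJ NM.
  rewrite (big_rem (N' fJ)) /=; last first.
    by rewrite mem_index_iota prime_vector_prod_gt0 ltnS.
  rewrite max_pdiv_prime_vector_prod // eqxx mulr1 lerDl.
  by apply: sumr_ge0 => n _; rewrite mulr_ge0.
rewrite exchange_big /= big_seq_cond [leRHS]big_seq_cond.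
apply: ler_sum => n /andP[+ _]; rewrite mem_index_iota => /andP[n0 _].
rewrite -mulr_sumr ler_wpM2l // -natr_sum ler_nat.
apply: leq_trans (card_shift K n0).
rewrite -sum1_card big_mkcond [leqRHS]big_mkcond /=; apply: leq_sum => fJ _.
by rewrite inE -/(N' _); case: (N' fJ == n); case: ifP.
Qed.

Lemma brun_sum_sets (o : bool) c (w : I -> R) (Q : pred {set I}) (G : {set I} -> R) :
  (forall J, 0 <= G J) ->
  (forall J, J \in brun w o c desc_primes -> Q [set p in J]%SET) ->
  \sum_(J <- brun w o c desc_primes) G [set p in J]%SET <= \sum_(J | Q J) G J.
Proof.
move=> G0 QJ; pose S := [seq [set p in J]%SET | J <- brun w o c desc_primes].
have uS : uniq S.
  rewrite map_inj_in_uniq ?brun_uniq ?desc_primes_uniq // => J J' /brun_subseq + /brun_subseq.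
  move=> /(subseq_uniqP desc_primes_uniq) EJ /(subseq_uniqP desc_primes_uniq) EJ' /setP h.
  by rewrite EJ EJ'; apply: eq_filter => p; have := h p; rewrite !inE.
have -> : \sum_(J <- brun w o c desc_primes) G [set p in J]%SET = \sum_(J <- S) G J.
  by rewrite big_map.
rewrite big_uniq //= big_mkcond [leRHS]big_mkcond /=; apply: ler_sum => J _.
case: ifP => [/mapP[J' /QJ h ->]|_]; first by rewrite h.
by case: ifP.
Qed.
End Counting.

Section Combine.
Context {R : realType} {y : R} (a : int).
Local Notation I := (primes_upto y).
Local Notation N := prime_vector_prod.

(** For each vector [f] the credit [b] is chosen so that every modulus used by
    the sieve is at most [z]. The relative error [exp (- b L)] is then a constant
    times [(N f / z) ^ (L / ln y)]. When [b < 0] this exceeds [1], and bounding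
    the deficit by the model mass suffices. The sum of these errors is the moment
    of [model_moment_le]. *)
Lemma sum_deficit_le K (z L e : R) (h : nat -> R) (mu : {ffun I -> 'I_K.+1} -> R)
    (D : pred {ffun I -> 'I_K.+1}) :
  2 <= y -> 0 < z -> 0 < L -> 0 < e -> L / ln y <= 1 - e ->
  (forall f, 0 <= mu f) ->
  (forall (f : {ffun I -> 'I_K.+1}) b, \sum_(J <- brun (brun_weight L) false b (@desc_primes R y))
     (-1) ^+ size J * h (N (shift (fun p : I => f p : nat) [set p in J]%SET)) <= mu f) ->
  \sum_(f | D f) (\prod_(p : I) pmass a p (f p) - mu f) <=
  \sum_(1 <= n < (Num.truncn z).+1 | (max_pdiv n)%:R <= y)
     `|h n - ptail a n| * (2 ^ size (primes n))%N%:R +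
  expR (L + 4 * (expR L + 2) - L / ln y * ln z +
        4 / (1 - expR (- (e * ln 2))) * expR L).
Proof.
move=> y2 z0 L0 e0 Le mu0 hmu.
have lny : 0 < ln y by rewrite ln_gt0 //; lra.
pose NN (f : {ffun I -> 'I_K.+1}) : nat := N (fun p : I => f p : nat).
pose nu (f : {ffun I -> 'I_K.+1}) := \prod_(p : I) pmass a p (f p) : R.
have nu0 f : 0 <= nu f by apply: prodr_ge0 => p _; rewrite pmass_ge0 ?prime_valP.
pose S (f : {ffun I -> 'I_K.+1}) : R := \sum_(J : {set I} | (N (shift (fun p : I => f p : nat) J) <= Num.truncn z)%N)
   (fun n => `|h n - ptail a n|) (N (shift (fun p : I => f p : nat) J)).
have S0 f : 0 <= S f by apply: sumr_ge0.
pose B := expR (L + 4 * (expR L + 2) - L / ln y * ln z).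
have key f : nu f - mu f <= S f + nu f * expR (L / ln y * ln (NN f)%:R) * B.
  pose b := (ln z - ln (NN f)%:R) / ln y - 1 - brun_weight_level L.
  have bE : expR (- (b * L)) = expR (L / ln y * ln (NN f)%:R) * B.
    rewrite -expRD; congr expR; rewrite /b /brun_weight_level; field.
    by rewrite !gt_eqF.
  rewrite -mulrA -bE.
  have [nuf0|nuf0] := eqVneq (nu f) 0.
    by rewrite nuf0 mul0r addr0 sub0r (le_trans _ (S0 f)) // oppr_le0.
  have [b0|b0] := ltP b 0.
    have : 1 <= expR (- (b * L)).
      by rewrite -{1}expR0 ler_expR oppr_ge0 mulr_le0_ge0 // ltW.
    move=> /(ler_wpM2l (nu0 f)); have := S0 f; have := mu0 f; lra.
  (* The sieve bounds the mass of A below by s2; s1 is the same sum for the model. *)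
  have hd := @model_defect R y a L (fun p : I => f p : nat) b L0 nuf0.
  have hm := hmu f b.
  set s1 := \sum_(J <- _) _ in hd; set s2 := \sum_(J <- _) _ in hm.
  have : s1 - s2 <= S f.
    rewrite /s1 /s2 -sumrB.
    apply: le_trans (@brun_sum_sets _ y false b (brun_weight L) _
      (fun J => `|h (N (shift (fun p : I => f p : nat) J)) - ptail a (N (shift (fun p : I => f p : nat) J))|) _ _) => //; last first.
      move=> J Jb; rewrite truncn_ge_nat; last exact: ltW.
      rewrite -ler_ln ?posrE ?ltr0n ?prime_vector_prod_gt0 //.
      apply: le_trans (brun_product_le _ y2 L0 b0 Jb) _.
      rewrite -/(NN f) /b le_eqVlt; apply/orP; left; apply/eqP.
      by field; rewrite gt_eqF.
    apply: ler_sum => J _; rewrite -mulrBr -normrN opprB.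
    apply: le_trans (ler_norm _) _.
    by rewrite normrM normrX normrN1 expr1n mul1r.
  rewrite -/(nu f) in hd; lra.
apply: (@le_trans _ _ (\sum_f (S f + nu f * expR (L / ln y * ln (NN f)%:R) * B))).
  rewrite big_mkcond; apply: ler_sum => f _; case: ifP => _; first exact: key.
  by rewrite addr_ge0 ?mulr_ge0 ?expR_ge0.
rewrite big_split /=; apply: lerD.
  apply: sum_shift_le => [|n]; [lra|exact: normr_ge0].
rewrite -mulr_suml expRD mulrC ler_wpM2l ?expR_ge0 //.
have s0 : 0 <= L / ln y by rewrite divr_ge0 // ltW.
have := @model_moment_le R y a K (L / ln y) e y2 s0 e0 Le.
by rewrite divfK // gt_eqF.
Qed.
End Combine.

(** * Passage to the probability spaces *)

(** The Weierstrass product inequality. *)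
Lemma prod_onem_ge (R : realType) (J : Type) (s : seq J) (F : J -> R) :
  (forall j, 0 <= F j <= 1) -> 1 - \sum_(j <- s) F j <= \prod_(j <- s) (1 - F j).
Proof.
move=> F01; have : 1 - \sum_(j <- s) F j <= \prod_(j <- s) (1 - F j) <= 1.
  elim: s => [|j s /andP[IH1 IH2]]; first by rewrite !big_nil subr0 lexx.
  rewrite !big_cons; have /andP[F0 F1] := F01 j.
  have : 0 <= \prod_(i <- s) (1 - F i).
    by apply: prodr_ge0 => i _; have := F01 i; lra.
  by move: (\prod_(_ <- s) _) (\sum_(_ <- s) _) IH1 IH2 => q t; nra.
by case/andP.
Qed.

Section Box.
Context {R : realType} {y : R} (a : int).
Local Notation I := (primes_upto y).

(** Restricting to a finite box of exponents makes all sums over vectors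
    finite, at the cost of an arbitrarily small [delta]. *)
Lemma box_mass (delta : R) : 0 < delta ->
  exists K, 1 - \sum_(f : {ffun I -> 'I_K.+1}) \prod_(p : I) pmass a p (f p) <= delta.
Proof.
move=> d0; pose M : R := #|{: I}|%:R; exists (Num.truncn (M / delta)).
set K := Num.truncn _.
rewrite (@sum_box_prod R y _ (fun p k => pmass a p k)).
under eq_bigr do rewrite sum_pmass.
have tl (p : I) : tail a p K.+1 <= (K.+1%:R)^-1 :> R.
  apply: le_trans (tailS_le a K (prime_valP p)) _.
  have p2 : (1 < p)%N by rewrite prime_gt1 ?prime_valP.
  have -> : (K.+1%:R)^-1 = 1 * (K.+1%:R)^-1 :> R by rewrite mul1r.
  apply: ler_pM; rewrite ?divr_ge0 ?invr_ge0 ?ler0n //.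
    by rewrite ler_pdivrMr ?ltr0n 1?ltnW // mul1r ler_nat.
  rewrite lef_pV2 ?posrE ?ltr0n ?expn_gt0 ?(ltnW p2) // ler_nat.
  apply: leq_trans (_ : 2 ^ K <= _)%N; first exact: ltn_expl.
  by case: (K) => [|k]; rewrite ?expn0 ?leq_exp2r.
have : 1 - \sum_(p : I) tail a p K.+1 <= \prod_(p : I) (1 - tail a p K.+1) :> R.
  apply: prod_onem_ge => p; rewrite tail_ge0 /=; apply: le_trans (tl p) _.
  by rewrite invf_le1 ?ltr0n // ler1n.
have : \sum_(p : I) tail a p K.+1 <= \sum_(p : I) (K.+1%:R)^-1 :> R.
  by apply: ler_sum => p _; exact: tl.
have -> : \sum_(p : I) (K.+1%:R)^-1 = M / K.+1%:R :> R.
  by rewrite sumr_const -[LHS]mulr_natl.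
have : M / K.+1%:R <= delta.
  rewrite ler_pdivrMr ?ltr0n // mulrC -ler_pdivrMr //.
  by apply/ltW; rewrite -truncn_le_nat.
move=> h1 h2 h3; apply: le_trans h1; apply: le_trans h2.
by rewrite lerBlDr addrC -lerBlDr.
Qed.
End Box.

Lemma fine_measure_le (R : realType) d (T : measurableType d)
    (P : probability T R) (S S' : set T) : measurable S -> measurable S' ->
  S `<=` S' -> fine (P S) <= fine (P S').
Proof.
by move=> mS mS' SS; rewrite fine_le ?fin_num_measure // le_measure ?inE.
Qed.

Lemma fine_measure_finite (R : realType) d (T : measurableType d)
    (P : probability T R) (Omega : Type) (J : finType) (Z : T -> Omega)
    (phi : J -> Omega) (D : pred J) :
  injective phi -> (forall E, measurable (Z @^-1` E)) ->
  fine (P (Z @^-1` [set phi j | j in [set j | D j]])) =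
  \sum_(j | D j) fine (P (Z @^-1` [set phi j])).
Proof.
move=> phiI mZ; rewrite -big_enum /=.
have -> : [set phi j | j in [set j | D j]] = [set phi j | j in [set` enum D]].
  by apply/seteqP; split => w [j /= Dj <-]; exists j => //=; move: Dj; rewrite mem_enum.
have := enum_uniq D; elim: (enum D) => [|j s IH].
  rewrite big_nil => _; rewrite (_ : _ @^-1` _ = set0) ?measure0 //.
  by apply/seteqP; split => // t [].
move=> /= /andP[js us]; rewrite big_cons -(IH us).
rewrite (fine_measure_setIC P (mZ _) (mZ [set phi j])); congr (fine (P _) + fine (P _)).
  apply/seteqP; split => t /= => [[_ ->]//|->]; split => //.
  by exists j => //=; rewrite mem_head.
apply/seteqP; split => t /=.
  move=> [[i + <-] ij]; rewrite /= inE => /orP[/eqP E|si]; last by exists i.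
  by case: ij; rewrite E.
move=> [i si <-]; split; first by exists i => //=; rewrite inE si orbT.
by move=> /phiI E; move: js; rewrite -E si.
Qed.

Section TwoSides.
Context {R : realType} {y : R} (a : int).
Local Notation I := (primes_upto y).
Local Notation N := prime_vector_prod.

Section ASide.
Context d (T : measurableType d) (P : probability T R) (A : {RV P >-> nat}).
Let X (t : T) : {ffun I -> nat} := [ffun p : I => logn p (A t)].

Lemma measurable_valuations (E : set {ffun I -> nat}) : measurable (X @^-1` E).
Proof.
by have := @measurable_funPTI _ _ _ _ A [set n | E [ffun p : I => logn p n]]; apply.
Qed.

Context (A0 : forall t, (0 < A t)%N).

(** The vector equals [f] when it is at least [f] and no prime occurs once
    more; the intersections in [brun_lower_bound] are then the events that
    [N (shift f J)] divides [A]. *)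
Lemma brun_valuations (w : I -> R) (c : R) (f : {ffun I -> nat}) :
  \sum_(J <- brun w false c desc_primes) (-1) ^+ size J *
     fine (P [set t | N (shift f [set p in J]%SET) %| A t]%N)
  <= fine (P (X @^-1` [set f])).
Proof.
have mA (S : set nat) : measurable (A @^-1` S) by exact: measurable_funPTI.
pose C (p : I) := A @^-1` [set n | f p < logn p n]%N.
pose B := A @^-1` [set n | forall p : I, (f p <= logn p n)%N].
have := @brun_lower_bound R d T P I w C false c desc_primes B.
move=> /(_ (fun p => mA _) (mA _)); rewrite /= mul1r subr_ge0 => h.
have -> : X @^-1` [set f] = B `&` \big[setI/setT]_(p <- desc_primes) ~` C p.
  rewrite -bigcap_seq; apply/seteqP; split => t /=.
    move=> Xf; split => [p|p _]; rewrite /C /= -Xf ffunE //.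
    by rewrite ltnn.
  move=> [Bt Ct]; apply/ffunP => p; rewrite ffunE; apply/eqP.
  rewrite eqn_leq Bt andbT leqNgt; apply/negP; apply: Ct.
  by rewrite /= mem_sort mem_enum.
apply: le_trans h; rewrite le_eqVlt; apply/orP; left; apply/eqP.
apply: eq_big_seq => J Jb; congr (_ * fine (P _)).
rewrite -bigcap_seq; apply/seteqP; split => t /=.
  rewrite prime_vector_prod_dvd // => /forallP h; split => [p|p pJ] /=.
    by apply: leq_trans (h p); rewrite /shift leq_addr.
  by have := h p; rewrite /shift inE (_ : p \in J) ?addn1.
move=> [Bt Ct]; rewrite prime_vector_prod_dvd //; apply/forallP => p.
rewrite /shift inE; case: (boolP (p \in J)) => pJ; last by rewrite addn0.
by rewrite addn1; exact: Ct.
Qed.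
End ASide.

Section GSide.
Context d' (T' : measurableType d') (P' : probability T' R) (G : I -> {RV P' >-> nat}).
Let Y (t : T') : {ffun I -> nat} := [ffun p : I => G p t].

Lemma measurable_random_vector (E : set {ffun I -> nat}) : measurable (Y @^-1` E).
Proof.
have -> : Y @^-1` E = \bigcup_(f : {ffun I -> nat})
    (if `[< E f >] then \big[setI/setT]_(p <- enum {: I}) (G p @^-1` [set f p]) else set0).
  apply/seteqP; split => t /=.
    move=> Et; exists (Y t) => //; rewrite asboolT // -bigcap_seq => p _ /=.
    by rewrite ffunE.
  move=> [f _]; case: asboolP => // Ef; rewrite -bigcap_seq => h.
  suff -> : Y t = f by [].
  by apply/ffunP => p; rewrite ffunE; apply: h; rewrite /= mem_enum.
apply: countable_bigcupT_measurable => [|f]; first exact: countableP.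
case: asboolP => // _; apply: bigsetI_measurable => p _.
exact: measurable_funPTI.
Qed.

Context (indep : mutually_independent G).
Context (Gmass : forall p : I, ~~ (p%:Z %| a)%Z ->
     forall k : nat, P' (G p @^-1` [set k]) =
       ((totient (p ^ k))%:R^-1 - (totient (p ^ k.+1))%:R^-1)%:E).
Context (G0 : forall p : I, (p%:Z %| a)%Z -> forall t : T', G p t = 0%N).

Lemma model_mass (f : {ffun I -> nat}) :
  fine (P' (Y @^-1` [set f])) = \prod_(p : I) pmass a p (f p).
Proof.
have -> : Y @^-1` [set f] = \bigcap_(p in [set` [set: I]%SET]) (G p @^-1` [set f p]).
  apply/seteqP; split => t /= => [<- p _|h] /=; first by rewrite ffunE.
  by apply/ffunP => p; rewrite ffunE; apply: h; rewrite /= inE.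
rewrite (indep _ (E := fun p => [set f p])) //.
rewrite (eq_bigr (fun p : I => (pmass a p (f p))%:E)); last first.
  move=> p _; have [pa|pa] := boolP ((prime_val p)%:Z %| a)%Z; last first.
    by rewrite Gmass // /pmass /tail (negbTE pa).
  rewrite /pmass /tail pa /=.
  case E: (f p) => [|k] /=.
    rewrite (_ : _ @^-1` _ = setT) ?probability_setT ?subr0 //.
    by apply/seteqP; split => t //= _; exact: G0.
  rewrite (_ : _ @^-1` _ = set0) ?measure0 ?subrr //.
  by apply/seteqP; split => t //=; rewrite G0.
by rewrite prodEFin /=; apply: eq_bigl => p; rewrite inE.
Qed.

Context d (T : measurableType d) (P : probability T R) (A : {RV P >-> nat}).
Let X (t : T) : {ffun I -> nat} := [ffun p : I => logn p (A t)].
Definition box_vector K (f : {ffun I -> 'I_K}) : {ffun I -> nat} := [ffun p => f p : nat].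

Lemma box_vector_inj K : injective (@box_vector K).
Proof.
move=> f g /ffunP h; apply/ffunP => p; apply: val_inj.
by have := h p; rewrite !ffunE.
Qed.

(** Outside the box the model mass is bounded by its total there and the mass
    of [A] from below by [0]. *)
Lemma one_sided_le K (E : set {ffun I -> nat}) :
  fine (P' (Y @^-1` E)) - fine (P (X @^-1` E)) <=
  \sum_(f : {ffun I -> 'I_K} | `[< E (box_vector f) >])
     (\prod_(p : I) pmass a p (f p) - fine (P (X @^-1` [set box_vector f])))
  + (1 - \sum_(f : {ffun I -> 'I_K}) \prod_(p : I) pmass a p (f p)).
Proof.
pose D (f : {ffun I -> 'I_K}) := `[< E (box_vector f) >].
pose ED := [set box_vector f | f in [set f | D f]].
pose bx := [set box_vector f | f in [set f : {ffun I -> 'I_K} | predT f]].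
have mX := @measurable_valuations _ _ P A; have mY := measurable_random_vector.
have massE (f : {ffun I -> 'I_K}) :
    fine (P' (Y @^-1` [set box_vector f])) = \prod_(p : I) pmass a p (f p).
  by rewrite model_mass; apply: eq_bigr => p _; rewrite ffunE.
have EDE : ED `<=` E by move=> _ [f /asboolP h <-].
have h1 : fine (P (X @^-1` ED)) <= fine (P (X @^-1` E)).
  by apply: (fine_measure_le _ (mX _) (mX _)) => t /= /EDE.
rewrite (fine_measure_finite P D (@box_vector_inj K) mX) in h1.
have h2 : fine (P' (Y @^-1` E)) <= fine (P' (Y @^-1` ED)) + fine (P' (Y @^-1` (~` bx))).
  rewrite (fine_measure_setIC P' (mY E) (mY bx)); apply: lerD.
    apply: (fine_measure_le _ (measurableI _ _ (mY _) (mY _)) (mY _)).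
    by move=> t /= [Et [f _ fE]]; exists f => //=; apply/asboolP; rewrite fE.
  apply: (fine_measure_le _ _ (mY _)); last by move=> t [].
  exact: (measurableI _ _ (mY _) (mY (~` _))).
have h3 : fine (P' (Y @^-1` (~` bx))) = 1 - fine (P' (Y @^-1` bx)).
  have := fine_measure_setIC P' measurableT (mY bx).
  by rewrite !setTI probability_setT /= => ->; rewrite addrC addKr.
rewrite h3 (fine_measure_finite P' D (@box_vector_inj K) mY) in h2.
rewrite (fine_measure_finite P' predT (@box_vector_inj K) mY) in h2.
rewrite (eq_bigr _ (fun f _ => massE f)) in h2.
rewrite [X in 1 - X](eq_bigr _ (fun f _ => massE f)) in h2.
rewrite sumrB; lra.
Qed.
End GSide.
End TwoSides.

(** * The error term and the conclusion *)

(** A multiple of [u ^ (1 - e)] is at most [eta * u] as soon as [u ^ e] exceeds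
    [c / eta]; smaller [u] are absorbed in the constant. *)
Lemma powR_sublinear (R : realType) (c eta e : R) : 0 < c -> 0 < eta -> 0 < e < 1 ->
  exists C, forall u, 1 <= u -> c * expR ((1 - e) * ln u) <= C + eta * u.
Proof.
move=> c0 eta0 /andP[e0 e1]; exists (c * expR (ln (c / eta) / e)) => u u1.
have u0 : 0 < u by lra.
have lu : 0 <= ln u by rewrite ln_ge0.
have K0 : 0 <= c * expR (ln (c / eta) / e) by rewrite mulr_ge0 ?expR_ge0 // ltW.
have [h|h] := leP (c / eta) (expR (e * ln u)).
  have : c * expR ((1 - e) * ln u) <= eta * u.
    rewrite -[X in eta * X](lnK) ?posrE //.
    have -> : ln u = e * ln u + (1 - e) * ln u by ring.
    rewrite [X in _ <= eta * X]expRD mulrA.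
    rewrite (_ : (1 - e) * (e * ln u + (1 - e) * ln u) = (1 - e) * ln u); last by ring.
    by rewrite ler_wpM2r ?expR_ge0 // mulrC -ler_pdivrMr.
  lra.
have : expR ((1 - e) * ln u) <= expR (ln (c / eta) / e).
  rewrite ler_expR; apply: (@le_trans _ _ (ln u)); first by nra.
  rewrite ler_pdivlMr // mulrC -[leLHS]expRK ler_ln ?posrE ?expR_gt0 ?divr_gt0 //; exact: ltW.
have : 0 <= eta * u by rewrite mulr_ge0 // ltW.
by move=> h1 /(ler_wpM2l (ltW c0)); lra.
Qed.

Section DTV.
Context (R : realType) (d d' : measure_display)
    (T : measurableType d) (T' : measurableType d')
    (P : probability T R) (P' : probability T' R)
    (Omega : countType) (X : T -> Omega) (Y : T' -> Omega).
Context (mX : forall E, measurable (X @^-1` E)) (mY : forall E, measurable (Y @^-1` E)).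

(** Passing to the complement of [E] reverses the sign of the difference, so an
    upper bound for one sign over all [E] bounds the distance. *)
Lemma dTV_le_one_sided (B : R) :
  (forall E, fine (P' (Y @^-1` E)) - fine (P (X @^-1` E)) <= B) -> dTV P P' X Y <= B.
Proof.
move=> h; apply: ge_sup; first by exists `|fine (P (X @^-1` set0)) - fine (P' (Y @^-1` set0))|; exists set0.
move=> _ [E _ <-]; rewrite ler_norml.
have compl d0 (T0 : measurableType d0) (Q : probability T0 R) (Z : T0 -> Omega) :
    (forall E, measurable (Z @^-1` E)) -> fine (Q (Z @^-1` E)) + fine (Q (Z @^-1` (~` E))) = 1.
  by move=> mZ; have := fine_measure_setIC Q measurableT (mZ E); rewrite !setTI probability_setT.
have := compl _ _ P X mX; have := compl _ _ P' Y mY.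
by have := h E; have := h (~` E); lra.
Qed.

Lemma dTV_le1 : dTV P P' X Y <= 1.
Proof.
apply: dTV_le_one_sided => E.
have : 0 <= fine (P (X @^-1` E)) by rewrite fine_ge0.
have : fine (P' (Y @^-1` E)) <= 1.
  by have := fine_measure_le P' (mY E) measurableT (@subsetT _ _); rewrite probability_setT.
lra.
Qed.
End DTV.

(** With [s = min(u, y)] and [expR L = s ^ (1 - e)], the saving
    [L / ln y * ln (x ^ theta)] equals [theta (1 - e) u ln s], while all other
    terms are [O(u ^ (1 - e))] and are absorbed by half of the loss [eps].
    The two terms on the right are the cases [s = u] and [s = y]. *)
Lemma error_exponent (R : realType) (theta eps : R) : 0 < theta < 1 -> 0 < eps < 1 ->
  exists2 C, 0 < C & forall x y u e L : R, 2 <= y <= x -> 2 <= u ->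
  u = ln x / ln y -> e = eps / 2 -> L = (1 - e) * ln (Num.min u y) ->
  expR (L + 4 * (expR L + 2) - L / ln y * ln (x `^ theta) +
        4 / (1 - expR (- (e * ln 2))) * expR L) <=
  C * (u `^ (- (theta * u * (1 - eps))) + x `^ (- (theta * (1 - eps)))).
Proof.
move=> /andP[t0 t1] /andP[eps0 eps1]; pose e := eps / 2.
have e0 : 0 < e by rewrite /e; lra.
have e1 : e < 1 by rewrite /e; lra.
have l2 : 0 < ln 2 :> R by rewrite ln_gt0 // ltr1n.
have rho1 : expR (- (e * ln 2)) < 1 by rewrite -[ltRHS]expR0 ltr_expR oppr_lt0 mulr_gt0.
pose c := 5 + 4 / (1 - expR (- (e * ln 2))).
have c0 : 0 < c by rewrite addr_gt0 // divr_gt0 // subr_gt0.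
have eta0 : 0 < theta * e * ln 2 by rewrite !mulr_gt0.
have [C HC] := powR_sublinear c0 eta0 (introT andP (conj e0 e1)).
exists (expR (8 + C)); first exact: expR_gt0.
move=> x y u e' L /andP[y2 yx] u2 uE -> EL; rewrite -/e in EL *.
have lny : 0 < ln y by rewrite ln_gt0 //; lra.
have lnx : 0 < ln x by rewrite ln_gt0 //; lra.
have x0 : 0 < x by lra.
pose s := Num.min u y.
have s2 : 2 <= s by rewrite le_min u2.
have su : s <= u by rewrite ge_min lexx.
have lns2 : ln 2 <= ln s by rewrite ler_ln ?posrE //; lra.
have lns : 0 < ln s by apply: lt_le_trans lns2.
have lnsu : ln s <= ln u by rewrite ler_ln ?posrE //; lra.
have LE : L <= expR L by apply: le_trans (expR_ge1Dx L); rewrite lerDr.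
have EE : expR L <= expR ((1 - e) * ln u) by rewrite ler_expR EL ler_wpM2l //; lra.
have hC : c * expR L <= C + theta * e * ln 2 * u.
  have u1 : 1 <= u by lra.
  by apply: le_trans (HC u u1); rewrite ler_wpM2l // ltW.
have main : L + 4 * (expR L + 2) - L / ln y * ln (x `^ theta) +
        4 / (1 - expR (- (e * ln 2))) * expR L <=
    (8 + C) + (- (theta * (1 - eps) * (u * ln s))).
  rewrite ln_powR {3}EL -/s.
  have -> : (1 - e) * ln s / ln y * (theta * ln x) = theta * (1 - e) * (u * ln s).
    by rewrite uE; ring.
  have -> : 1 - eps = 1 - e - e by rewrite /e; field.
  have : theta * e * ln 2 * u <= theta * e * (u * ln s).
    have teu : 0 <= theta * e * u by rewrite !mulr_ge0 //; lra.
    have := ler_wpM2l teu lns2; lra.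
  move: hC LE; rewrite /c mulrDl; lra.
apply: le_trans (_ : expR ((8 + C) + (- (theta * (1 - eps) * (u * ln s)))) <= _).
  by rewrite ler_expR.
rewrite expRD ler_wpM2l ?expR_ge0 //.
have pu : 0 <= u `^ (- (theta * u * (1 - eps))) by exact: powR_ge0.
have px : 0 <= x `^ (- (theta * (1 - eps))) by exact: powR_ge0.
have [uy|uy] := leP u y.
  have -> : expR (- (theta * (1 - eps) * (u * ln s))) = u `^ (- (theta * u * (1 - eps))).
    rewrite /powR gt_eqF; last lra.
    by congr expR; rewrite /s min_l //; ring.
  by rewrite lerDl.
have -> : expR (- (theta * (1 - eps) * (u * ln s))) = x `^ (- (theta * (1 - eps))).
  rewrite /powR gt_eqF //; congr expR; rewrite /s min_r; last exact: ltW.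
  by rewrite uE; field; rewrite gt_eqF.
by rewrite lerDr.
Qed.

Lemma primes_sum_split (R : realType) (y : R) (a : int) (M : nat) (h : nat -> R) :
  a != 0 -> 1 <= y -> (forall n, 0 <= h n) ->
  \sum_(1 <= n < M.+1 | (max_pdiv n)%:R <= y)
     `|h n - ptail a n| * (2 ^ size (primes n))%N%:R <=
  \sum_(1 <= n < M.+1 | ((max_pdiv n)%:R <= y) && (gcdz n a == 1))
      `|h n - (totient n)%:R^-1| * ((2 ^ size (primes n))%:R + ln y)
  + \sum_(1 <= n < M.+1 | ((max_pdiv n)%:R <= y) && (1 < gcdz n a))
      h n * ((2 ^ size (primes n))%:R + ln y).
Proof.
move=> a0 y1 h0; have l0 : 0 <= ln y by exact: ln_ge0.
rewrite (bigID (fun n : nat => gcdz n a == 1)) /=; apply: lerD.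
  apply: ler_sum => n /andP[_ g1].
  by rewrite /ptail g1 ler_wpM2l // lerDl.
rewrite (eq_bigl (fun n : nat => ((max_pdiv n)%:R <= y) && (1 < gcdz n a))).
  apply: ler_sum => n /andP[_ g1].
  by rewrite /ptail gt_eqF // subr0 ger0_norm // ler_wpM2l // lerDl.
move=> n; congr (_ && _); rewrite lt_neqAle eq_sym.
have : (0 < gcdn n `|a|)%N by rewrite gcdn_gt0 absz_gt0 a0 orbT.
by rewrite /gcdz /= => g0; rewrite (_ : 1 <= _ = true) ?andbT.
Qed.

Theorem corollary2p2 (R : realType) (a : int) (theta eps : R) :
  a != 0 -> 0 < theta < 1 -> 0 < eps ->
  exists2 C : R, 0 < C &
  forall (x y : R) (d d' : measure_display)
    (T : measurableType d) (P : probability T R) (A : {RV P >-> nat})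
    (T' : measurableType d') (P' : probability T' R)
    (G : primes_upto y -> {RV P' >-> nat}),
  2 <= y <= x ->
  (forall t : T, (1 <= A t)%N /\ (A t)%:R <= x) ->
  mutually_independent G ->
  (forall p : primes_upto y, ~~ (p%:Z %| a)%Z ->
     forall k : nat, P' (G p @^-1` [set k]) =
       ((totient (p ^ k))%:R^-1 - (totient (p ^ k.+1))%:R^-1)%:E) ->
  (forall p : primes_upto y, (p%:Z %| a)%Z -> forall t : T', G p t = 0%N) ->
  let u := ln x / ln y in
  let Pdvd n := fine (P [set t | n %| A t]%N) in
  dTV P P' (fun t => [ffun p : primes_upto y => logn p (A t)])
           (fun t => [ffun p : primes_upto y => G p t])
  <= C * (u `^ (- (theta * u * (1 - eps)))
          + x `^ (- (theta * (1 - eps)))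
          + \sum_(1 <= n < (Num.truncn (x `^ theta)).+1 |
                    ((max_pdiv n)%:R <= y) && (gcdz n a == 1))
              `|Pdvd n - (totient n)%:R^-1|
                * ((2 ^ size (primes n))%:R + ln y)
          + \sum_(1 <= n < (Num.truncn (x `^ theta)).+1 |
                    ((max_pdiv n)%:R <= y) && (1 < gcdz n a))
              Pdvd n * ((2 ^ size (primes n))%:R + ln y)).
Proof.
move=> a0 theta01 eps0; have /andP[theta0 theta1] := theta01.
have [C0 C0p HC0] : exists2 C, 0 < C & eps < 1 ->
  forall x y u e L : R, 2 <= y <= x -> 2 <= u ->
  u = ln x / ln y -> e = eps / 2 -> L = (1 - e) * ln (Num.min u y) ->
  expR (L + 4 * (expR L + 2) - L / ln y * ln (x `^ theta) +
        4 / (1 - expR (- (e * ln 2))) * expR L) <=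
  C * (u `^ (- (theta * u * (1 - eps))) + x `^ (- (theta * (1 - eps)))).
  have [eps1|eps1] := ltP eps 1; last by exists 1.
  have [|C C0 HC] := @error_exponent R theta eps theta01; first by rewrite eps0.
  by exists C.
exists (4 + C0); first by rewrite addr_gt0.
move=> x y d d' T P A T' P' G /andP[y2 yx] hA indep Gmass G0.
cbv zeta; set u := ln x / ln y; set Pdvd := fun n : nat => fine _.
set S1 := \sum_(1 <= n < _ | _) _; set S2 := \sum_(1 <= n < _ | _) _.
set U := u `^ _; set X := x `^ (- _).
have Pdvd0 n : 0 <= Pdvd n by rewrite fine_ge0.
have lny : 0 < ln y by rewrite ln_gt0 //; lra.
have S10 : 0 <= S1.
  by apply: sumr_ge0 => n _; rewrite mulr_ge0 // addr_ge0 // ltW.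
have S20 : 0 <= S2.
  by apply: sumr_ge0 => n _; rewrite mulr_ge0 // addr_ge0 // ltW.
have U0 : 0 <= U by exact: powR_ge0.
have X0 : 0 <= X by exact: powR_ge0.
have mX := @measurable_valuations R y _ T P A.
have mY := @measurable_random_vector R y _ T' P' G.
have triv : 4^-1 <= U + X -> dTV P P' (fun t => [ffun p : primes_upto y => logn p (A t)])
           (fun t => [ffun p : primes_upto y => G p t]) <= (4 + C0) * (U + X + S1 + S2).
  by move=> h; apply: le_trans (dTV_le1 P P' mX mY) _; nra.
have x1 : 1 <= x by lra.
have lnx : 0 < ln x by rewrite ln_gt0 //; lra.
have u1 : 1 <= u by rewrite ler_pdivlMr // mul1r ler_ln ?posrE //; lra.
(* For eps >= 1, and for u < 2, one of the two powers is at least 1/4, so dTV <= 1 suffices. *)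
have [eps1|eps1] := leP 1 eps.
  apply: triv; suff : 1 <= X by lra.
  rewrite /X /powR gt_eqF; last lra.
  rewrite -{1}expR0 ler_expR mulr_ge0 ?(ltW lnx) // oppr_ge0 mulr_ge0_le0 //; lra.
have [u2|u2] := ltP u 2.
  apply: triv; suff : 4^-1 <= U by lra.
  have lu0 : 0 <= ln u by exact: ln_ge0.
  have lu2 : ln u <= ln 2 by rewrite ler_ln ?posrE //; lra.
  have -> : 4^-1 = expR (- (2 * ln 2)) :> R.
    by rewrite expRN expRM_natl lnK ?posrE // -natrX.
  rewrite /U /powR gt_eqF; last lra.
  have u0 : 0 <= u by lra.
  have tu0 : 0 <= theta * u by rewrite mulr_ge0 // ltW.
  have tu2 : theta * u <= 1 * 2 by rewrite ler_pM // ltW.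
  have eps10 : 0 <= 1 - eps by rewrite subr_ge0 ltW.
  have eps11 : 1 - eps <= 1 by rewrite gerBl ltW.
  have te : theta * u * (1 - eps) <= 1 * 2 * 1 by rewrite ler_pM.
  rewrite mulr1 mul1r in te; rewrite ler_expR mulNr lerN2.
  by apply: ler_pM => //; exact: mulr_ge0.
apply: dTV_le_one_sided => // E.
apply/ler_addgt0Pr => delta delta0.
have [K HK] := @box_mass R y a delta delta0.
apply: le_trans (@one_sided_le R y a _ T' P' G indep Gmass G0 _ T P A K.+1 E) _.
rewrite addrC [leRHS]addrC; apply: lerD => //.
pose e := eps / 2; pose L := (1 - e) * ln (Num.min u y).
have lmin : 0 < ln (Num.min u y) by rewrite ln_gt0 // lt_min; apply/andP; split; lra.
have L0 : 0 < L by rewrite mulr_gt0 // /e; lra.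
have Le : L / ln y <= 1 - e.
  rewrite ler_pdivrMr // ler_wpM2l //; first by rewrite /e; lra.
  rewrite ler_ln ?posrE ?lt_min ?ge_min ?lexx ?orbT //; last lra.
  by apply/andP; split; lra.
have z0 : 0 < x `^ theta by apply: powR_gt0; lra.
have e0 : 0 < e by rewrite /e; lra.
have := @sum_deficit_le R y a K (x `^ theta) L e Pdvd
  (fun f => fine (P ((fun t => [ffun p : primes_upto y => logn p (A t)]) @^-1` [set box_vector f])))
  (fun f => `[< E (box_vector f) >]) y2 z0 L0 e0 Le.
move=> /(_ _ _)/le_trans; apply.
- by move=> f; rewrite fine_ge0.
- move=> f b.
  have := @brun_valuations R y _ T P A _ (brun_weight L) b (box_vector f).
  move=> /(_ (fun t => (hA t).1)) /(le_trans _); apply.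
  rewrite le_eqVlt; apply/orP; left; apply/eqP; apply: eq_bigr => J _.
  suff -> : prime_vector_prod (shift (fun p : primes_upto y => f p : nat) [set p in J]%SET)
    = prime_vector_prod (shift (box_vector f) [set p in J]%SET) by [].
  by apply: eq_bigr => p _; rewrite /shift ffunE.
have y1 : 1 <= y by lra.
have := @primes_sum_split R y a (Num.truncn (x `^ theta)) Pdvd a0 y1 Pdvd0.
have := HC0 eps1 x y u e L _ u2 erefl erefl erefl; rewrite y2 yx => /(_ isT) /=.
rewrite -/U -/X -/S1 -/S2.
move: (expR _) (\sum_(_ <= _ < _ | _) _) => q1 q2 h1 h2.
nra.
Qed.
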